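(* Let $D$ be a weighted oriented cycle of length $n$ with $n\equiv 2\pmod 3$, with underlying graph $G=C_n=x_1\cdots x_nx_1$, such that every vertex of $V^+$ is a sink. Then $$\operatorname{reg}(I(D))=\operatorname{reg}(I(G))+\sum_{x_i\in V^+}(w(x_i)-1).$$
   Context: A weighted oriented graph $D=(V(D),E(D),w)$ has directed edges $(x,y)$ and weights $w:V(D)\to\{1,2,\dots\}$; a source is assumed to have weight $1$. Its edge ideal is $I(D)=(x_ix_j^{w(x_j)}:(x_i,x_j)\in E(D))$ in the polynomial ring over a field whose variables are the vertices; $I(G)$ is the usual squarefree edge ideal of the simple underlying graph $G$. $V^+=\{x\in V(D): w(x)\ge 2\}$. A sink is a vertex all of whose incident edges are oriented into it. $\operatorname{reg}$ is Castelnuovo–Mumford regularity. *)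

(* Defs.v *)
From mathcomp Require Import all_boot all_order all_algebra.
From mathcomp.multinomials Require Import mpoly.
From Stdlib Require Import ClassicalEpsilon.

Set Implicit Arguments.
Unset Strict Implicit.
Unset Printing Implicit Defensive.

Import Order.TTheory GRing.Theory Num.Theory.
Local Open Scope ring_scope.

(* Graphs have vertex set 'I_n, so that the vertices are the variables of     *)
(* {mpoly K[n]}.                                                              *)
Record sgraph (n : nat) := SGraph {
  edge : rel 'I_n;
  edge_sym : ssrbool.symmetric edge;
  edge_irrefl : irreflexive edge
}.

(* Asymmetry of arcs says that each edge of the underlying simple graph is    *)
(* oriented in exactly one direction; it also excludes loops.                 *)
Record wograph (n : nat) := WOGraph {
  arc : rel 'I_n;
  wt : 'I_n -> nat;
  arc_asym : forall x y, arc x y -> ~~ arc y x;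
  wt_gt0 : forall x, (0 < wt x)%N;
  wt_source : forall x, (forall y, ~~ arc y x) -> wt x = 1%N
}.

Section Graphs.
Variable n : nat.

Definition under_edge (D : wograph n) : rel 'I_n :=
  fun x y => arc D x y || arc D y x.

Lemma under_edge_sym (D : wograph n) : ssrbool.symmetric (under_edge D).
Proof. by move=> x y; rewrite /under_edge orbC. Qed.

Lemma under_edge_irrefl (D : wograph n) : irreflexive (under_edge D).
Proof.
move=> x; rewrite /under_edge orbb; apply/negP => xx.
by have /negP := arc_asym xx; apply.
Qed.

Definition underlying (D : wograph n) : sgraph n :=
  SGraph (@under_edge_sym D) (@under_edge_irrefl D).

Definition sink (D : wograph n) (x : 'I_n) : Prop :=
  forall y, under_edge D x y -> arc D y x.

Definition Vplus (D : wograph n) : {set 'I_n} := [set x | (2 <= wt D x)%N].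

(* G is the cycle x_0 x_1 ... x_(n-1) x_0; ordS is the cyclic successor.      *)
(* Meaningful for n >= 3 only.                                                *)
Definition is_cycle (G : sgraph n) : Prop :=
  forall x y, edge G x y = (y == ordS x) || (x == ordS y).

End Graphs.

Section Ideals.
Variables (K : fieldType) (n : nat).
Local Notation S := {mpoly K[n]}.

Definition ideal_gen (T : finType) (P : pred T) (g : T -> S) : S -> Prop :=
  fun p => exists c : T -> S, p = \sum_(t | P t) c t * g t.

Definition edge_ideal (G : sgraph n) : S -> Prop :=
  ideal_gen (fun e : 'I_n * 'I_n => edge G e.1 e.2)
            (fun e => 'X_(e.1) * 'X_(e.2)).

Definition wo_edge_ideal (D : wograph n) : S -> Prop :=
  ideal_gen (fun e : 'I_n * 'I_n => arc D e.1 e.2)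
            (fun e => 'X_(e.1) * 'X_(e.2) ^+ wt D e.2).

End Ideals.

Arguments edge_ideal K {n} G.
Arguments wo_edge_ideal K {n} D.

Section Regularity.
Variables (K : fieldType) (n : nat).
Local Notation S := {mpoly K[n]}.

(* A sequence of maps ... -> F_1 -> F_0 -> S of free modules, where           *)
(* F_i = \bigoplus_a S(- shift i a) is the module of row vectors of length    *)
(* rk i and maps act by right multiplication. Shifts are natural numbers,     *)
(* which loses nothing when resolving an ideal of S.                          *)
Record gfcomplex := GFComplex {
  rk : nat -> nat;
  shift : forall i, 'I_(rk i) -> nat;
  aug : 'cV[S]_(rk 0);
  diff : forall i, 'M[S]_(rk i.+1, rk i)
}.

Definition graded (F : gfcomplex) : Prop :=
  (forall a, aug F a 0 \is (shift a).-homog) /\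
  (forall i (a : 'I_(rk F i.+1)) (b : 'I_(rk F i)),
     if (shift b <= shift a)%N then diff F i a b \is (shift a - shift b).-homog
     else diff F i a b == 0).

Definition resolves (F : gfcomplex) (I : S -> Prop) : Prop :=
  [/\ forall p, I p <-> exists v : 'rV_(rk F 0), v *m aug F = p%:M,
      forall v : 'rV_(rk F 0),
        v *m aug F = 0 <-> exists u, v = u *m diff F 0
    & forall i (v : 'rV_(rk F i.+1)),
        v *m diff F i = 0 <-> exists u, v = u *m diff F i.+1].

Definition finite_length (F : gfcomplex) : Prop :=
  exists l, forall i, (l < i)%N -> rk F i = 0%N.

(* All entries of the differentials lie in the irrelevant maximal ideal.      *)
Definition minimal (F : gfcomplex) : Prop :=
  forall i a b, (diff F i a b)@_0%MM = 0.

Definition min_graded_free_resolution (I : S -> Prop) (F : gfcomplex) : Prop :=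
  [/\ graded F, resolves F I, finite_length F & minimal F].

Definition betti (F : gfcomplex) (i j : nat) : nat :=
  #|[set a : 'I_(rk F i) | shift a == j]|.

Definition is_reg (I : S -> Prop) (r : int) : Prop :=
  exists F, [/\ min_graded_free_resolution I F,
    exists i j, betti F i j <> 0%N /\ r = j%:Z - i%:Z
  & forall i j, betti F i j <> 0%N -> j%:Z - i%:Z <= r].

(* Every nonzero homogeneous ideal has a minimal graded free resolution,      *)
(* unique up to isomorphism, so is_reg I determines r; the value is           *)
(* unspecified for other I.                                                   *)
Definition reg (I : S -> Prop) : int := epsilon (inhabits 0) (is_reg I).

End Regularity.

(* Main.v *)
Require Import Defs.
From mathcomp Require Import all_boot all_order all_algebra.
From mathcomp.multinomials Require Import mpoly.
From mathcomp Require Import zify ring.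
From Stdlib Require Import ClassicalEpsilon.

(** Every vertex of weight at least 2 is a sink, so each generator of I(D) is
    y_i y_(i+1) with y_i = x_i^(w_i): I(D) is the image of I(C_n) under the flat
    substitution x_i |-> y_i. Hence a squarefree multigraded resolution of I(C_n)
    also resolves I(D), the basis elements of multidegree a now having degree
    \sum_(i in a) w_i. For n = 3k+2 the regularity k+2 of I(C_n) is attained at
    the full multidegree, where the shift \sum_i (w_i - 1) is largest.

    The resolution of the cycle is assembled from mapping cones over paths, adding
    one edge at a time; the cone need not be minimal, but cancelling pairs of equal
    multidegree in consecutive homological degrees cannot affect the full
    multidegree, which occurs in homological degree 2k+1 only (counting S itself as
    degree 0). Two minimal resolutions of the same ideal have the same nonzero
    graded Betti numbers because comparison maps compose to the identity modulo the
    irrelevant maximal ideal. *)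

Set Implicit Arguments.
Unset Strict Implicit.
Unset Printing Implicit Defensive.

Import GRing.Theory.
Local Open Scope ring_scope.

(** * Multigraded frames *)

Section Frames.
Variables (K : fieldType) (V : finType).
Implicit Types (D : pred {set V}) (U A a : {set V}).

Definition monotone D := forall U U', U \subset U' -> D U -> D U'.

(* The scalar matrices of a multigraded complex of free S-modules resolving S/I,
   where I is the squarefree monomial ideal with x^U in I iff D U. The nonzero
   entry from s to t stands for fdiff s t times the monomial flab s / flab t, so
   that the strand of the complex in multidegree U is spanned by the cells with
   label inside U. For D U false that strand is just the base cell. *)
Record frame D := Frame {
  fcell :> finType;
  fdeg : fcell -> nat;
  flab : fcell -> {set V};
  fdiff : fcell -> fcell -> K;
  fbase : fcell;
  fdiff_supp : forall s t, fdiff s t != 0 ->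
    (fdeg s == (fdeg t).+1) && (flab t \subset flab s);
  fdiff_sq : forall r t, \sum_s fdiff r s * fdiff s t = 0;
  fdeg_eq0 : forall t, (fdeg t == 0%N) = (t == fbase);
  flab_base : flab fbase = set0;
  flab_dep : forall t, t != fbase -> D (flab t);
  fexact : forall U (v : fcell -> K), D U ->
    (forall t, ~~ (flab t \subset U) -> v t = 0) ->
    (forall t, \sum_s v s * fdiff s t = 0) ->
    exists u : fcell -> K, (forall t, ~~ (flab t \subset U) -> u t = 0) /\
      forall t, v t = \sum_s u s * fdiff s t
}.

Definition fgen D (F : frame D) i a :=
  exists t : F, fdeg t = i /\ flab t = a.

Definition fminimal D (F : frame D) :=
  forall s t : F, fdiff s t != 0 -> flab t != flab s.

Lemma fdiff_eq0 D (F : frame D) (s t : F) :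
  ~~ ((fdeg s == (fdeg t).+1) && (flab t \subset flab s)) -> fdiff s t = 0.
Proof. by move=> h; apply/eqP; apply: contraNT h => /fdiff_supp. Qed.

Lemma fdiff_deg0 D (F : frame D) (s t : F) : fdeg s != (fdeg t).+1 -> fdiff s t = 0.
Proof. by move=> h; apply: fdiff_eq0; rewrite (negPf h). Qed.

Lemma fdeg_base D (F : frame D) : fdeg (fbase F) = 0%N.
Proof. by apply/eqP; rewrite fdeg_eq0. Qed.

Lemma fdiff_base D (F : frame D) (t : F) : fdiff (fbase F) t = 0.
Proof. by apply: fdiff_deg0; rewrite fdeg_base. Qed.

Lemma fdiff_sub D (F : frame D) U (s t : F) :
  flab s \subset U -> ~~ (flab t \subset U) -> fdiff s t = 0.
Proof.
move=> sU tU; apply: fdiff_eq0; apply: contra tU => /andP[_ ts].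
exact: subset_trans ts sU.
Qed.

Lemma frame_ext D D' : D =1 D' -> forall F : frame D,
  exists F' : frame D', forall i a, fgen F' i a <-> fgen F i a.
Proof.
move=> DD' F.
by exists (@Frame D' F (@fdeg D F) (@flab D F) (@fdiff D F) (fbase F)
  (@fdiff_supp D F) (@fdiff_sq D F) (@fdeg_eq0 D F) (@flab_base D F)
  (fun t tb => etrans (esym (DD' _)) (flab_dep tb))
  (fun U v DU => @fexact D F U v (etrans (DD' U) DU))).
Qed.

Lemma frame_false : exists F : frame xpred0,
  forall i a, fgen F i a <-> i = 0%N /\ a = set0.
Proof.
unshelve eexists (@Frame xpred0 unit (fun=> 0%N) (fun=> set0) (fun _ _ => 0) tt
  _ _ _ _ _ _) => /=.
- by move=> s t; rewrite eqxx.
- by move=> r t; rewrite big1 // => s _; rewrite mul0r.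
- by case.
- by [].
- by case.
- by [].
- by move=> i a; split=> [[t [<- <-]]|[-> ->]] //; exists tt.
Qed.

Section Comparison.
Variables (D1 D2 : pred {set V}) (F1 : frame D1) (F2 : frame D2) (A : {set V}).
Hypothesis mD2 : monotone D2.
Hypothesis D21 : forall U, A \subset U -> D2 U = D1 U.

Lemma comparison_upto i : exists phi : F2 -> F1 -> K,
  [/\ forall s t, phi s t != 0 ->
        (fdeg t == fdeg s) && (flab t \subset flab s :|: A),
      phi (fbase F2) (fbase F1) = 1 &
      forall s, (fdeg s <= i)%N -> forall t,
        \sum_r phi s r * fdiff r t = \sum_r fdiff s r * phi r t].
Proof.
elim: i => [|i [phi [supp phib comm]]].
  exists (fun s t => ((s == fbase F2) && (t == fbase F1))%:R); split.
  - move=> s t; case: andP => [[/eqP -> /eqP ->] _|_]; last by rewrite eqxx.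
    by rewrite !fdeg_base !flab_base eqxx sub0set.
  - by rewrite !eqxx.
  - move=> s; rewrite leqn0 fdeg_eq0 => /eqP -> t.
    rewrite (bigD1 (fbase F1)) //= !eqxx mul1r fdiff_base add0r.
    rewrite big1 => [|r /negPf ->]; last by rewrite andbF mul0r.
    by rewrite big1 // => r _; rewrite fdiff_base mul0r.
pose v s t := \sum_r fdiff s r * phi r t.
have vsupp s t : v s t != 0 ->
    (fdeg s == (fdeg t).+1) && (flab t \subset flab s :|: A).
  move=> nz; have [/existsP[r] |] := boolP [exists r, fdiff s r * phi r t != 0].
    rewrite mulf_eq0 negb_or => /andP[/fdiff_supp/andP[/eqP -> rs] /supp/andP[/eqP -> tr]].
    by rewrite eqxx (subset_trans tr) // setSU.
  rewrite negb_exists => /forallP z; case/eqP: nz.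
  by rewrite /v big1 // => r _; apply/eqP; rewrite -[_ == _]negbK; exact: z.
have lift s : exists u : F1 -> K, fdeg s = i.+1 ->
    (forall t, u t != 0 -> (fdeg t == fdeg s) && (flab t \subset flab s :|: A)) /\
    forall t, \sum_r u r * fdiff r t = v s t.
  have [ds|i0] := eqVneq (fdeg s) i.+1; last by exists (fun=> 0) => /eqP; rewrite (negPf i0).
  have sb : s != fbase F2 by rewrite -fdeg_eq0 ds.
  have Ds : D1 (flab s :|: A).
    by rewrite -D21 ?subsetUr //; apply: mD2 (flab_dep sb); rewrite subsetUl.
  have [|t|u [usupp uv]] := @fexact D1 F1 _ (v s) Ds.
  - by move=> t tU; apply: contraNeq tU => /vsupp/andP[].
  - rewrite /v; under eq_bigr => q _ do rewrite mulr_suml.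
    rewrite exchange_big /= (eq_bigr (fun r => \sum_q fdiff s r * fdiff r q * phi q t)).
      by rewrite exchange_big big1 //= => q _; rewrite -mulr_suml fdiff_sq mul0r.
    move=> r _; under eq_bigr => q _ do rewrite -mulrA.
    under [RHS]eq_bigr => q _ do rewrite -mulrA.
    rewrite -!mulr_sumr; have [dr|dr] := eqVneq (fdeg s) (fdeg r).+1.
      by rewrite comm //; move: dr; rewrite ds => -[->].
    by rewrite fdiff_deg0 ?mul0r.
  exists (fun t => if fdeg t == fdeg s then u t else 0) => _; split.
  - move=> t /=; case: (fdeg t =P _) => [_ nz|]; last by rewrite eqxx.
    by apply: contraNT nz => /usupp ->.
  - move=> t; have [dt|dt] := eqVneq (fdeg s) (fdeg t).+1.
      rewrite uv; apply: eq_bigr => r _; case: eqP => [//|nr].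
      by rewrite fdiff_deg0 ?mulr0 //; apply/eqP; rewrite -dt.
    rewrite big1 => [|r _]; last first.
      case: eqP => [rs|]; last by rewrite mul0r.
      by rewrite fdiff_deg0 ?mulr0 // rs.
    by apply/esym/eqP; apply: contraNT dt => /vsupp/andP[].
  have [psi psiP] := fin_all_exists lift.
  pose phi' s t := if fdeg s == i.+1 then psi s t else phi s t.
  exists phi'; split.
  - move=> s t; rewrite /phi'; case: (fdeg s =P _) => [/psiP[h _]|_]; [exact: h|exact: supp].
  - by rewrite /phi' fdeg_base.
  - move=> s si t; have phi'r r : fdiff s r * phi' r t = fdiff s r * phi r t.
      rewrite /phi'; case: eqP => // ri; rewrite fdiff_deg0 ?mul0r // ri.
      by apply: contraTneq si => ->; rewrite ltnn.
    under [RHS]eq_bigr => r _ do rewrite phi'r.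
    rewrite /phi'; case: eqP => [/psiP[_ h]|/eqP ne]; first exact: h.
    by apply: comm; move: si; rewrite leq_eqVlt (negPf ne) ltnS.
Qed.

Lemma comparison : exists phi : F2 -> F1 -> K,
  [/\ forall s t, phi s t != 0 ->
        (fdeg t == fdeg s) && (flab t \subset flab s :|: A),
      phi (fbase F2) (fbase F1) = 1 &
      forall s t, \sum_r phi s r * fdiff r t = \sum_r fdiff s r * phi r t].
Proof.
have [phi [h1 h2 h3]] := comparison_upto (\max_(s : F2) fdeg s).
by exists phi; split=> // s; apply: h3; apply: leq_bigmax.
Qed.
End Comparison.

Section Cone.
Variables (D1 D2 : pred {set V}) (F1 : frame D1) (F2 : frame D2) (A : {set V}).
Hypotheses (mD1 : monotone D1) (mD2 : monotone D2).
Hypothesis D21 : forall U, A \subset U -> D2 U = D1 U.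
Variable phi : F2 -> F1 -> K.
Hypothesis phi_supp : forall s t, phi s t != 0 ->
  (fdeg t == fdeg s) && (flab t \subset flab s :|: A).
Hypothesis phi_base : phi (fbase F2) (fbase F1) = 1.
Hypothesis phi_comm : forall s t,
  \sum_r phi s r * fdiff r t = \sum_r fdiff s r * phi r t.

Let D U := D1 U || (A \subset U).
Let cdeg (x : F1 + F2) := match x with inl t => fdeg t | inr t => (fdeg t).+1 end.
Let clab (x : F1 + F2) := match x with inl t => flab t | inr t => flab t :|: A end.
Let cdiff (x y : F1 + F2) := match x, y with
  | inl s, inl t => fdiff s t
  | inl _, inr _ => 0
  | inr s, inl t => phi s t
  | inr s, inr t => - fdiff s t
  end.

Lemma cone_diff_supp s t : cdiff s t != 0 ->
  (cdeg s == (cdeg t).+1) && (clab t \subset clab s).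
Proof.
case: s t => [s|s] [t|t] /=; first exact: fdiff_supp.
- by rewrite eqxx.
- by case/phi_supp/andP=> /eqP -> ->; rewrite eqxx.
- by rewrite oppr_eq0 => /fdiff_supp/andP[/eqP -> st]; rewrite eqxx setSU.
Qed.

Lemma cone_diff_sq r t : \sum_s cdiff r s * cdiff s t = 0.
Proof.
rewrite big_sumType /=; case: r t => [r|r] [t|t] /=.
- rewrite fdiff_sq add0r big1 // => s _; exact: mul0r.
- by rewrite !big1 ?addr0 // => s _; rewrite ?mulr0 ?mul0r.
- rewrite phi_comm -big_split big1 //= => s _; ring.
- rewrite big1 ?add0r => [|s _]; last exact: mulr0.
  under eq_bigr => s _ do rewrite mulrNN.
  exact: fdiff_sq.
Qed.

Lemma cone_deg_eq0 t : (cdeg t == 0%N) = (t == inl (fbase F1)).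
Proof. by case: t => t //=; rewrite fdeg_eq0. Qed.

Lemma cone_lab_dep t : t != inl (fbase F1) -> D (clab t).
Proof.
rewrite /D; case: t => t /= tb; last by rewrite subsetUr orbT.
by rewrite flab_dep.
Qed.

Lemma cone_exact U (v : F1 + F2 -> K) : D U ->
  (forall t, ~~ (clab t \subset U) -> v t = 0) ->
  (forall t, \sum_s v s * cdiff s t = 0) ->
  exists u : F1 + F2 -> K, (forall t, ~~ (clab t \subset U) -> u t = 0) /\
    forall t, v t = \sum_s u s * cdiff s t.
Proof.
move=> DU vU vZ.
have vZ1 t : \sum_s v (inl s) * fdiff s t + \sum_s v (inr s) * phi s t = 0.
  by have := vZ (inl t); rewrite big_sumType.
have vZ2 t : \sum_s v (inr s) * fdiff s t = 0.
  have := vZ (inr t); rewrite big_sumType /= big1 ?add0r => [|s _]; last exact: mulr0.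
  by under eq_bigr => s _ do rewrite mulrN; rewrite sumrN => /eqP; rewrite oppr_eq0 => /eqP.
have [AU|AU] := boolP (A \subset U); last first.
  have {DU} D1U : D1 U by move: DU; rewrite /D (negPf AU) orbF.
  have v2 s : v (inr s) = 0.
    by apply: vU; apply: contra AU => /(subset_trans _); apply; rewrite subsetUr.
  have [|t|u [uU uv]] := @fexact D1 F1 U (v \o inl) D1U; first by move=> t; exact: (vU (inl t)).
    by rewrite /= -[RHS](vZ1 t) [X in _ + X]big1 ?addr0 // => s _; rewrite v2 mul0r.
  exists (fun x => if x is inl t then u t else 0); split; first by case.
  move=> t; rewrite big_sumType /= [X in _ + X]big1 ?addr0 => [|s _]; last exact: mul0r.
  case: t => t; first exact: uv.
  by rewrite v2 big1 // => s _; rewrite mulr0.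
have labU (t : F2) : (flab t :|: A \subset U) = (flab t \subset U) by rewrite subUset AU andbT.
have [D1U|nD1U] := boolP (D1 U).
  have D2U : D2 U by rewrite D21.
  have [|t|u2 [u2U u2v]] := @fexact D2 F2 U (v \o inr) D2U.
  - by move=> t tU; apply: vU; rewrite /= labU.
  - exact: vZ2.
  have [|t|u1 [u1U u1v]] := @fexact D1 F1 U
    (fun t => v (inl t) + \sum_s u2 s * phi s t) D1U.
  - move=> t tU; rewrite vU // add0r big1 // => s _.
    have [sU|/u2U ->] := boolP (flab s \subset U); last by rewrite mul0r.
    case: (eqVneq (phi s t) 0) => [->|]; first by rewrite mulr0.
    case/phi_supp/andP=> _ ts; case/negP: tU; apply: subset_trans ts _.
    by rewrite labU.
  - under eq_bigr => s _ do rewrite mulrDl mulr_suml.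
    rewrite big_split exchange_big /= -[RHS](vZ1 t); congr (_ + _).
    under eq_bigr => s _.
      under eq_bigr => r _ do rewrite -mulrA.
      rewrite -mulr_sumr phi_comm mulr_sumr; over.
    rewrite exchange_big /=; apply: eq_bigr => r _.
    have -> : v (inr r) = \sum_s u2 s * fdiff s r by exact: u2v.
    by rewrite mulr_suml; apply: eq_bigr => s _; rewrite mulrA.
  exists (fun x => match x with inl t => u1 t | inr t => - u2 t end); split.
    by case=> t /=; [exact: u1U|rewrite labU => /u2U ->; rewrite oppr0].
  move=> t; rewrite big_sumType /=; case: t => t /=.
    rewrite -u1v -addrA -big_split big1 ?addr0 //= => s _; ring.
  rewrite big1 ?add0r => [|s _]; last exact: mulr0.
  under eq_bigr => s _ do rewrite mulrNN.
  exact: u2v.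
have only1 (t : F1) : flab t \subset U -> t = fbase F1.
  by move=> tU; apply: contraNeq nD1U => /flab_dep; apply: mD1.
have only2 (t : F2) : flab t \subset U -> t = fbase F2.
  move=> tU; apply: contraNeq nD1U => /flab_dep; rewrite -D21 //; exact: mD2.
have v1 t : t != fbase F1 -> v (inl t) = 0.
  by move=> tb; apply: vU; apply: contra tb => /only1 ->.
have v2 t : t != fbase F2 -> v (inr t) = 0.
  by move=> tb; apply: vU; apply: contra tb => /=; rewrite labU => /only2 ->.
have v2b t : v (inr t) = 0.
  have [->|/v2 //] := eqVneq t (fbase F2).
  have := vZ1 (fbase F1); rewrite big1 ?add0r => [|s _]; last first.
    have [->|/v1 ->] := eqVneq s (fbase F1); last by rewrite mul0r.
    by rewrite fdiff_base mulr0.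
  rewrite (bigD1 (fbase F2)) //= phi_base mulr1 big1 ?addr0 // => s /v2 ->.
  by rewrite mul0r.
exists (fun x => if x is inr t then (if t == fbase F2 then v (inl (fbase F1)) else 0) else 0).
split.
  case=> t //=; rewrite labU; case: eqP => // ->.
  by rewrite flab_base sub0set.
move=> t; rewrite big_sumType /= big1 ?add0r => [|s _]; last exact: mul0r.
rewrite (bigD1 (fbase F2)) //= eqxx [X in _ + X]big1 ?addr0 => [|s /negPf ->]; last exact: mul0r.
case: t => t /=; last by rewrite v2b fdiff_base oppr0 mulr0.
have [->|tb] := eqVneq t (fbase F1); first by rewrite phi_base mulr1.
rewrite v1 //; case: (eqVneq (phi (fbase F2) t) 0) => [->|]; first by rewrite mulr0.
by case/phi_supp/andP; rewrite fdeg_base fdeg_eq0 (negPf tb).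
Qed.

Definition cone_frame : frame D :=
  Frame cone_diff_supp cone_diff_sq cone_deg_eq0 (flab_base F1) cone_lab_dep cone_exact.

End Cone.

Lemma cone D1 D2 A (F1 : frame D1) (F2 : frame D2) :
    monotone D1 -> monotone D2 -> (forall U, A \subset U -> D2 U = D1 U) ->
  exists F : frame (fun U => D1 U || (A \subset U)), forall i a,
    fgen F i a <->
    fgen F1 i a \/ exists j b, [/\ fgen F2 j b, i = j.+1 & a = b :|: A].
Proof.
move=> mD1 mD2 D21; have [phi [h1 h2 h3]] := comparison F1 F2 mD2 D21.
exists (cone_frame mD1 mD2 D21 h1 h2 h3) => i a; split.
  case=> -[t|t] /= [<- <-]; first by left; exists t.
  by right; exists (fdeg t), (flab t); split=> //; exists t.
case=> [[t [<- <-]]|[_ [_ [[t [<- <-]] -> ->]]]]; first by exists (inl t).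
by exists (inr t).
Qed.

Section Cancel.
Variables (D : pred {set V}) (F : frame D) (p q : F).
Hypotheses (D0 : ~~ D set0) (pq0 : fdiff p q != 0) (labpq : flab q = flab p).

Let kept : {pred F} := [pred t | (t != p) && (t != q)].
Let T : finType := {t : F | t \in kept}.
Let c := (fdiff p q)^-1.
Let e (s t : F) := fdiff s t - fdiff s q * c * fdiff p t.

Lemma pivot_deg : fdeg p = (fdeg q).+1.
Proof. by have /andP[/eqP] := fdiff_supp pq0. Qed.

Lemma pivot_neq : p != q.
Proof. by apply/eqP => E; move: pivot_deg; rewrite E; apply: n_Sn. Qed.

Lemma schur_row0 t : e p t = 0.
Proof. by rewrite /e mulfV // mul1r subrr. Qed.

Lemma schur_col0 s : e s q = 0.
Proof. by rewrite /e -mulrA mulVf // mulr1 subrr. Qed.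

Lemma sum_schur (f : F -> K) t : \sum_s f s * e s t =
  \sum_s f s * fdiff s t - (\sum_s f s * fdiff s q) * (c * fdiff p t).
Proof. by rewrite mulr_suml -sumrB; apply: eq_bigr => s _; rewrite /e; ring. Qed.

Lemma sum_kept (f : F -> K) :
  f p = 0 -> f q = 0 -> \sum_(s : T) f (val s) = \sum_s f s.
Proof.
move=> fp fq; rewrite -(big_sub kept f) [RHS](bigID (mem kept)) /=.
rewrite [X in _ = _ + X]big1 ?addr0 // => t.
by rewrite !inE negb_and !negbK => /orP[/eqP ->|/eqP ->].
Qed.

Lemma pivot_row_nbase : p != fbase F.
Proof. by rewrite -fdeg_eq0 pivot_deg. Qed.

Lemma pivot_col_nbase : q != fbase F.
Proof.
apply: contraNneq D0 => E; rewrite -(flab_base F) -E labpq.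
exact: flab_dep pivot_row_nbase.
Qed.

Lemma base_kept : fbase F \in kept.
Proof. by rewrite inE eq_sym pivot_row_nbase eq_sym pivot_col_nbase. Qed.

Let tdiff (s t : T) := e (val s) (val t).

Lemma cancel_diff_supp (s t : T) : tdiff s t != 0 ->
  (fdeg (val s) == (fdeg (val t)).+1) && (flab (val t) \subset flab (val s)).
Proof.
rewrite /tdiff /e; have [->|/fdiff_supp //] := eqVneq (fdiff (val s) (val t)) 0.
rewrite sub0r oppr_eq0 !mulf_eq0 !negb_or -andbA.
case/and3P=> /fdiff_supp/andP[/eqP -> qs] _ /fdiff_supp/andP[/eqP pt tp].
by rewrite -pt pivot_deg eqxx (subset_trans tp) // -labpq.
Qed.

Lemma cancel_diff_sq (r t : T) : \sum_s tdiff r s * tdiff s t = 0.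
Proof.
rewrite (sum_kept (f := fun s => e (val r) s * e s (val t))).
- rewrite sum_schur; set x := \sum_s _; set y := \sum_s _.
  suff E w : \sum_s e (val r) s * fdiff s w = 0 by rewrite /x /y !E mul0r subr0.
  rewrite /e; under eq_bigr => s _ do rewrite mulrBl -(mulrA (_ * c)).
  by rewrite sumrB -mulr_sumr !fdiff_sq mulr0 subr0.
- by rewrite schur_row0 mulr0.
- by rewrite schur_col0 mul0r.
Qed.

Let tbase : T := exist _ (fbase F) base_kept.

Lemma cancel_deg_eq0 (t : T) : (fdeg (val t) == 0%N) = (t == tbase).
Proof. by rewrite fdeg_eq0 -val_eqE. Qed.

Lemma cancel_lab_dep (t : T) : t != tbase -> D (flab (val t)).
Proof. by move=> tb; apply: flab_dep; rewrite -(inj_eq val_inj) in tb. Qed.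

Lemma cancel_exact U (v : T -> K) : D U ->
  (forall t, ~~ (flab (val t) \subset U) -> v t = 0) ->
  (forall t, \sum_s v s * tdiff s t = 0) ->
  exists u : T -> K, (forall t, ~~ (flab (val t) \subset U) -> u t = 0) /\
    forall t, v t = \sum_s u s * tdiff s t.
Proof.
move=> DU vU vZ.
pose v0 (t : F) := if insub t is Some t' then v t' else 0.
have v0T (t : T) : v0 (val t) = v t by rewrite /v0 valK.
have v0N t : t \notin kept -> v0 t = 0 by move=> tk; rewrite /v0 insubN.
have v0p : v0 p = 0 by rewrite v0N // inE eqxx.
have v0q : v0 q = 0 by rewrite v0N // inE eqxx andbF.
have v0U t : ~~ (flab t \subset U) -> v0 t = 0.
  by rewrite /v0; case: insubP => // t' _ <-; apply: vU.
have v0Z t : t != p -> \sum_s v0 s * e s t = 0.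
  have [->|tq tp] := eqVneq t q; first by rewrite big1 // => s _; rewrite schur_col0 mulr0.
  have tk : t \in kept by rewrite inE tp.
  rewrite -[RHS](vZ (exist _ t tk)) -(sum_kept (f := fun s => v0 s * e s t)).
  - by apply: eq_bigr => s _; rewrite v0T.
  - by rewrite v0p mul0r.
  - by rewrite v0q mul0r.
(* The coefficient at p making the q-coordinate of the boundary vanish; the
   p-coordinate then vanishes because the differential squares to zero. *)
pose x := - (\sum_s v0 s * fdiff s q) * c.
pose w t := if t == p then x else v0 t.
have wd t : \sum_s w s * fdiff s t = \sum_s v0 s * e s t.
  rewrite sum_schur (bigD1 p) //= [X in _ = X - _](bigD1 p) //= v0p mul0r add0r.
  rewrite addrC /w eqxx; congr (_ + _); last by rewrite /x; ring.
  by apply: eq_bigr => s /negPf ->.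
have xU : ~~ (flab p \subset U) -> x = 0.
  move=> pU; rewrite /x big1 ?oppr0 ?mul0r // => s _.
  have [sU|/v0U ->] := boolP (flab s \subset U); last by rewrite mul0r.
  by rewrite (fdiff_sub sU) ?mulr0 // labpq.
have wZ t : \sum_s w s * fdiff s t = 0.
  have [->|tp] := eqVneq t p; last by rewrite wd v0Z.
  have: \sum_r (\sum_s w s * fdiff s r) * fdiff r q = 0.
    under eq_bigr => r _ do rewrite mulr_suml.
    rewrite exchange_big big1 //= => s _; under eq_bigr => r _ do rewrite -mulrA.
    by rewrite -mulr_sumr fdiff_sq mulr0.
  rewrite (bigD1 p) //= [X in _ + X]big1 ?addr0 => [/eqP|r rp].
    by rewrite mulf_eq0 (negPf pq0) orbF => /eqP.
  by rewrite wd v0Z // mul0r.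
have wU t : ~~ (flab t \subset U) -> w t = 0.
  by rewrite /w; case: eqP => [->|_]; [exact: xU|exact: v0U].
have [u [uU uw]] := fexact DU wU wZ.
pose u' t := u t - u q * c * fdiff p t.
have u'q : u' q = 0 by rewrite /u' -mulrA mulVf // mulr1 subrr.
have u'd t : \sum_s u' s * fdiff s t = w t.
  rewrite /u'; under eq_bigr => s _ do rewrite mulrBl -(mulrA (u q * c)).
  by rewrite sumrB -mulr_sumr fdiff_sq mulr0 subr0 uw.
exists (u' \o val); split=> [t tU|t].
  rewrite /u' /= uU //; have [->|/eqP] := eqVneq (u q) 0; first by rewrite !mul0r subr0.
  have [qU _|/uU -> //] := boolP (flab q \subset U).
  by rewrite (@fdiff_sub _ _ U) ?mulr0 ?subr0 // -labpq.
rewrite -v0T (sum_kept (f := fun s => u' s * e s (val t))).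
- rewrite sum_schur !u'd /w [q == p]eq_sym (negPf pivot_neq) v0q mul0r subr0.
  by have /andP[/negPf -> _] := valP t.
- by rewrite schur_row0 mulr0.
- by rewrite u'q mul0r.
Qed.

Definition cancel_frame : frame D :=
  Frame cancel_diff_supp cancel_diff_sq cancel_deg_eq0 (flab_base F) cancel_lab_dep cancel_exact.

Lemma card_cancel : (#|cancel_frame| < #|F|)%N.
Proof.
rewrite card_sig; apply: proper_card; apply/properP; split; first exact/subsetP.
by exists p => //; rewrite !inE eqxx.
Qed.

Lemma fgen_cancel i a : fgen cancel_frame i a -> fgen F i a.
Proof. by case=> t [? ?]; exists (val t). Qed.

Lemma cancel_fgen i a : fgen F i a ->
  ~ fgen F i.+1 a -> (forall j, i = j.+1 -> ~ fgen F j a) -> fgen cancel_frame i a.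
Proof.
case=> t [ti ta] up dn; have tk : t \in kept.
  rewrite inE; apply/andP; split; apply/eqP => E.
    by case: (dn (fdeg q)); [rewrite -ti E pivot_deg|exists q; rewrite labpq -E].
  by case: up; exists p; rewrite pivot_deg -labpq -E ti.
by exists (exist _ t tk).
Qed.

End Cancel.

Lemma minimal_frame D (F : frame D) : ~~ D set0 ->
  exists F' : frame D, [/\ fminimal F', forall i a, fgen F' i a -> fgen F i a
    & forall i a, fgen F i a -> ~ fgen F i.+1 a ->
        (forall j, i = j.+1 -> ~ fgen F j a) -> fgen F' i a].
Proof.
move=> D0; have [k] := ubnP #|F|; elim: k F => // k IH F ltFk.
have [/existsP[p /existsP[q /andP[pq0 /eqP labpq]]]|nx] :=
    boolP [exists p : F, exists q : F, (fdiff p q != 0) && (flab q == flab p)].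
  have [|F' [mF' gen' keep]] := IH (cancel_frame D0 pq0 labpq).
    exact: leq_trans (card_cancel D0 pq0 labpq) ltFk.
  exists F'; split=> // [i a /gen'|i a Fi up dn]; first exact: fgen_cancel.
  apply: keep; first exact: cancel_fgen.
    by move/fgen_cancel.
  by move=> j ij /fgen_cancel; apply: dn.
exists F; split=> // s t st0; apply: contraNneq nx => E.
by apply/existsP; exists s; apply/existsP; exists t; rewrite st0 E eqxx.
Qed.

End Frames.

(** * Uniqueness of the regularity *)

Section Uniqueness.
Variables (K : fieldType) (n : nat).
Local Notation S := {mpoly K[n]}.

Definition mxhomog p q (s : 'I_p -> nat) (t : 'I_q -> nat) (M : 'M[S]_(p, q)) :=
  forall a b, if (t b <= s a)%N then M a b \is (s a - t b).-homog else M a b == 0.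

Definition mxproj p q (s : 'I_p -> nat) (t : 'I_q -> nat) (M : 'M[S]_(p, q)) :
    'M[S]_(p, q) :=
  \matrix_(a, b) if (t b <= s a)%N then pihomog mdeg (s a - t b) (M a b) else 0.

Lemma mxproj_homog p q (s : 'I_p -> nat) (t : 'I_q -> nat) (M : 'M[S]_(p, q)) :
  mxhomog s t (mxproj s t M).
Proof. by move=> a b; rewrite mxE; case: leqP => // _; apply: pihomogP. Qed.

Lemma mxhomogM p q r (s : 'I_p -> nat) (t : 'I_q -> nat) (u : 'I_r -> nat)
    (M : 'M[S]_(p, q)) (N : 'M[S]_(q, r)) :
  mxhomog s t M -> mxhomog t u N -> mxhomog s u (M *m N).
Proof.
move=> hM hN a c; rewrite mxE; case: leqP => uc.
  apply: rpred_sum => b _; have := hM a b; case: leqP => sb; last first.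
    by move/eqP ->; rewrite mul0r rpred0.
  move=> hMab; have := hN b c; case: leqP => ub; last first.
    by move/eqP ->; rewrite mulr0 rpred0.
  move=> hNbc; have -> : (s a - u c = (s a - t b) + (t b - u c))%N by lia.
  exact: dhomogM.
rewrite big1 // => b _; have := hM a b; case: leqP => [sb _|_ /eqP ->]; last by rewrite mul0r.
by have := hN b c; case: leqP => [ub|_ /eqP ->]; [lia|rewrite mulr0].
Qed.

Lemma pihomogMr d e (p q : S) : q \is e.-homog ->
  pihomog mdeg d (p * q) =
    if (e <= d)%N then pihomog mdeg (d - e) p * q else 0.
Proof.
move=> hq; rewrite [p]mpolyE mulr_suml !linear_sum /=.
transitivity (\sum_(m <- msupp p)
    if (e <= d)%N then pihomog mdeg (d - e) (p@_m *: 'X_[m]) * q else 0); last first.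
  by case: leqP => _; rewrite ?mulr_suml // big1.
apply: eq_bigr => m _; rewrite -scalerAl !linearZ /= -scalerAl pihomogX.
have hX : 'X_[K, m] * q \is (mdeg m + e).-homog by rewrite dhomogM ?dhomogX.
case: (eqVneq (mdeg m + e)%N d) => [E|ne].
  by rewrite pihomog_dE -?E ?leq_addl ?addnK ?eqxx.
rewrite (pihomog_ne0 ne hX) scaler0; case: leqP => // ed.
by rewrite -(eqn_add2r e) subnK // (negPf ne) mul0r scaler0.
Qed.

Lemma mxproj_mul p q r (s : 'I_p -> nat) (t : 'I_q -> nat) (u : 'I_r -> nat)
    (M : 'M[S]_(p, q)) (N : 'M[S]_(q, r)) :
  mxhomog t u N -> mxhomog s u (M *m N) -> mxproj s t M *m N = M *m N.
Proof.
move=> hN hMN; apply/matrixP => a c; have := hMN a c; case: leqP => uc; last first.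
  move/eqP ->; rewrite mxE big1 // => b _; rewrite mxE; case: leqP => tb; last by rewrite mul0r.
  by have := hN b c; case: leqP => [|_ /eqP ->]; [lia|rewrite mulr0].
move/pihomog_dE => <-; rewrite !mxE linear_sum /=; apply: eq_bigr => b _; rewrite mxE.
have := hN b c; case: leqP => ub; last by move/eqP ->; rewrite !mulr0 raddf0.
move=> hNbc; rewrite (pihomogMr _ _ hNbc).
case: leqP => tb.
  by rewrite ifT; [congr (pihomog _ _ _ * _); lia|lia].
by rewrite ifF ?mul0r //; lia.
Qed.

Section Lift.
Variables (F : gfcomplex K n) (I : S -> Prop).
Hypothesis resF : resolves F I.

Definition cycle i : 'rV[S]_(rk F i) -> Prop :=
  match i return 'rV[S]_(rk F i) -> Prop with
  | 0 => fun v => v *m aug F = 0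
  | i.+1 => fun v => v *m diff F i = 0
  end.

Lemma cycleP i v : @cycle i v <-> exists u, v = u *m diff F i.
Proof. by case: resF; case: i v => [|i] v _ h0 hS; [exact: h0|exact: hS]. Qed.

Lemma row_cycle i a : cycle (row a (diff F i)).
Proof. by apply/cycleP; exists (delta_mx 0 a); rewrite rowE. Qed.

Lemma mx_cycle p i (M : 'M[S]_(p, rk F i)) :
  (forall a, cycle (row a M)) -> exists N, M = N *m diff F i.
Proof.
move=> cM; have /fin_all_exists[u uP] a : exists u, row a M = u *m diff F i.
  exact/cycleP.
exists (\matrix_a u a); apply/row_matrixP => a.
by rewrite row_mul rowK uP.
Qed.

End Lift.

Section Compare.
Variables (F G : gfcomplex K n) (I : S -> Prop).
Hypotheses (mF : min_graded_free_resolution I F).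
Hypotheses (mG : min_graded_free_resolution I G).

Let resF : resolves F I. Proof. by case: mF. Qed.
Let resG : resolves G I. Proof. by case: mG. Qed.

Lemma lift_aug (H H' : gfcomplex K n) : resolves H I -> resolves H' I ->
  exists f, f *m aug H' = aug H.
Proof.
move=> [augH _ _] [augH' _ _].
have /fin_all_exists[u uP] a : exists u : 'rV_(rk H' 0), u *m aug H' = row a (aug H).
  have [u hu] : exists u : 'rV_(rk H' 0), u *m aug H' = (aug H a 0)%:M.
    apply/augH'/augH; exists (delta_mx 0 a); rewrite -rowE.
    by apply/rowP => j; rewrite !mxE !ord1 eqxx mulr1n.
  exists u; rewrite hu; apply/rowP => j; rewrite !mxE !ord1 eqxx mulr1n //.
by exists (\matrix_a u a); apply/row_matrixP => a; rewrite row_mul rowK uP.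
Qed.

Definition const_mx0 p q (M : 'M[S]_(p, q)) := map_mx (mcoeff 0%MM) M.

Lemma const_mx0M p q r (M : 'M[S]_(p, q)) (N : 'M[S]_(q, r)) :
  const_mx0 (M *m N) = const_mx0 M *m const_mx0 N.
Proof. exact: map_mxM. Qed.

Lemma const_mx0_1 p : const_mx0 (1%:M : 'M[S]_p) = 1%:M.
Proof. exact: map_mx1. Qed.

Lemma minimal_const (H : gfcomplex K n) i : minimal H -> const_mx0 (diff H i) = 0.
Proof. by move=> mH; apply/matrixP => a b; rewrite !mxE mH. Qed.

(* f and g lift the identity of the ideal and h is a homotopy from f g to 1; the
   conditions on cycles are all that the next step needs, so no coherent choice of
   f, g, h over all i is made. *)
Lemma compare i : exists (f : 'M[S]_(rk F i, rk G i)) (g : 'M[S]_(rk G i, rk F i))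
    (h : 'M[S]_(rk F i, rk F i.+1)),
  [/\ mxhomog (@shift _ _ F i) (@shift _ _ G i) f,
      forall v : 'rV_(rk F i), cycle v -> cycle (v *m f),
      forall v : 'rV_(rk G i), cycle v -> cycle (v *m g),
      forall v : 'rV_(rk F i), cycle v -> v *m (f *m g - 1%:M - h *m diff F i) = 0
    & const_mx0 (f *m g) = 1%:M].
Proof.
have [[augF difF] _ _ mcF] := mF; have [[augG difG] _ _ mcG] := mG.
elim: i => [|i [f [g [h [hf cf cg hfg fg1]]]]].
  have [f0 f0P] := lift_aug resF resG; have [g gP] := lift_aug resG resF.
  have haug (H : gfcomplex K n) : graded H -> mxhomog (@shift _ _ H 0) (fun=> 0%N) (aug H).
    by case=> hH _ a b; rewrite leq0n subn0 ord1.
  pose f := mxproj (@shift _ _ F 0) (@shift _ _ G 0) f0.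
  have fP : f *m aug G = aug F.
    by rewrite (@mxproj_mul _ _ _ _ _ (fun=> 0%N)) ?f0P //; apply: haug; [case: mG|case: mF].
  have [|h hP] := @mx_cycle F I resF _ 0 (f *m g - 1%:M).
    by move=> a /=; rewrite -row_mul mulmxBl -mulmxA gP fP mul1mx subrr row0.
  exists f, g, h; split.
  - exact: mxproj_homog.
  - by move=> v /= cv; rewrite -mulmxA fP.
  - by move=> v /= cv; rewrite -mulmxA gP.
  - by move=> v _; rewrite hP subrr mulmx0.
  - have : const_mx0 (f *m g - 1%:M) = 0 by rewrite hP const_mx0M minimal_const // mulmx0.
    by rewrite /const_mx0 map_mxB map_mx1 => /subr0_eq.
have [|f0 f0P] := @mx_cycle G I resG _ i (diff F i *m f).
  by move=> a; rewrite row_mul; apply/cf/(row_cycle resF).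
have [|g' g'P] := @mx_cycle F I resF _ i (diff G i *m g).
  by move=> a; rewrite row_mul; apply/cg/(row_cycle resG).
pose f' := mxproj (@shift _ _ F i.+1) (@shift _ _ G i.+1) f0.
have f'P : diff F i *m f = f' *m diff G i.
  rewrite (@mxproj_mul _ _ _ _ _ (@shift _ _ G i)) ?f0P //.
  by rewrite -f0P; apply: mxhomogM hf; exact: difF.
have [|h' h'P] := @mx_cycle F I resF _ i.+1 (f' *m g' - 1%:M - diff F i *m h).
  move=> a /=; rewrite -row_mul !mulmxBl -!mulmxA -g'P [f' *m _]mulmxA -f'P mul1mx.
  have : diff F i *m (f *m g - 1%:M - h *m diff F i) = 0.
    by apply/row_matrixP => b; rewrite row_mul hfg ?row0 //; exact: (row_cycle resF).
  by rewrite !mulmxBr mulmx1 !mulmxA => ->; rewrite row0.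
exists f', g', h'; split.
- exact: mxproj_homog.
- by move=> v /= cv; rewrite -mulmxA -f'P mulmxA cv mul0mx.
- by move=> v /= cv; rewrite -mulmxA -g'P mulmxA cv mul0mx.
- by move=> v /= cv; rewrite -h'P opprB addrC subrK mulmxA cv mul0mx.
- have : const_mx0 (f' *m g' - 1%:M - diff F i *m h) = 0.
    by rewrite h'P const_mx0M minimal_const // mulmx0.
  rewrite /const_mx0 !map_mxB -!/(const_mx0 _) const_mx0_1 !const_mx0M minimal_const //.
  by rewrite mul0mx subr0 => /subr0_eq.
Qed.

Lemma betti_neq0 i j : betti F i j <> 0%N -> betti G i j <> 0%N.
Proof.
move=> /eqP; rewrite -lt0n => /card_gt0P[a]; rewrite inE => /eqP aj.
have [f [g [h [hf _ _ _ /matrixP/(_ a a)]]]] := compare i.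
rewrite const_mx0M !mxE eqxx => E.
have [/existsP[b]|] := boolP [exists b, const_mx0 f a b * const_mx0 g b a != 0].
  rewrite mulf_eq0 negb_or !mxE => /andP[fab _].
  apply/eqP; rewrite -lt0n; apply/card_gt0P; exists b; rewrite inE -aj.
  have := hf a b; case: leqP => [ba|_ /eqP f0]; last by rewrite f0 mcoeff0 eqxx in fab.
  move=> hom; rewrite eqn_leq ba /= -subn_eq0 eq_sym.
  apply: contraNT fab => ne; apply/eqP; apply: (dhomog_nemf_coeff hom). by rewrite /= mdeg0.
rewrite negb_exists => /forallP z; have : (1%:R : K) != 0 by rewrite oner_eq0.
rewrite -E big1 ?eqxx // => b _; apply/eqP; rewrite -[_ == _]negbK; exact: z.
Qed.

End Compare.

Lemma is_reg_unique (I : S -> Prop) r r' : is_reg I r -> is_reg I r' -> r = r'.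
Proof.
move=> [F [mF [i [j [Fij ->]]] leF]] [G [mG [i' [j' [Gij ->]]] leG]].
apply: Order.POrderTheory.le_anti; apply/andP; split.
  by apply: leG; exact: (betti_neq0 mF mG Fij).
by apply: leF; exact: (betti_neq0 mG mF Gij).
Qed.

Lemma is_reg_reg (I : S -> Prop) r : is_reg I r -> reg I = r.
Proof.
move=> Ir; apply: is_reg_unique (Ir); rewrite /reg.
by apply: epsilon_spec; exists r.
Qed.

End Uniqueness.

(** * From frames to graded free resolutions *)

Section Realization.
Variables (K : fieldType) (n : nat) (w : 'I_n -> nat).
Hypothesis w_gt0 : forall i, (0 < w i)%N.
Local Notation S := {mpoly K[n]}.
Implicit Types (U : {set 'I_n}) (m : 'X_{1..n}).

Definition wmon (a : {set 'I_n}) : 'X_{1..n} := [multinom (if i \in a then w i else 0%N) | i < n].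

Definition full_exponents m : {set 'I_n} := [set i | (w i <= m i)%N].

Lemma wmon_le a m : (wmon a <= m)%MM = (a \subset full_exponents m).
Proof.
apply/mnm_lepP/subsetP => [h i ia|h i]; first by have := h i; rewrite mnmE ia inE.
by rewrite mnmE; case: ifP => // /h; rewrite inE.
Qed.

Lemma wmon_sub (a b : {set 'I_n}) : a \subset b -> (wmon a <= wmon b)%MM.
Proof.
by rewrite wmon_le => /subsetP ab; apply/subsetP => i /ab ib; rewrite inE mnmE ib.
Qed.

Lemma wmon0 : wmon set0 = 0%MM.
Proof. by apply/mnmP => i; rewrite !mnmE inE. Qed.

Lemma wmon_subE (a b : {set 'I_n}) : a \subset b -> (wmon b - wmon a == 0)%MM = (a == b).
Proof.
move=> ab; apply/eqP/eqP => [E|->]; last by apply/mnmP => i; rewrite !mnmE subnn.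
apply/eqP; rewrite eqEsubset ab; apply/subsetP => i ib; apply: contraT => ia.
by move/mnmP: E => /(_ i); rewrite !mnmE ib (negPf ia) subn0 => wi; have := w_gt0 i; rewrite wi.
Qed.

Lemma mdeg_wmon a : mdeg (wmon a) = (\sum_(i in a) w i)%N.
Proof. by rewrite mdegE [RHS]big_mkcond /=; apply: eq_bigr => i _; rewrite mnmE. Qed.

Lemma mdegB_le m m' : (m' <= m)%MM -> mdeg (m - m')%MM = (mdeg m - mdeg m')%N.
Proof. by move=> le; rewrite -{2}(submK le) mdegD addnK. Qed.

Lemma mpolyX_neq0 m : 'X_[K, m] != 0.
Proof.
by apply/eqP => /mpolyP/(_ m)/eqP; rewrite mcoeffX eqxx mcoeff0 oner_eq0.
Qed.

Lemma mcoeffMX_out (p : S) m k : ~~ (m <= k)%MM -> (p * 'X_[m])@_k = 0.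
Proof.
move=> mk; apply: memN_msupp_eq0; apply: contra mk.
by rewrite (perm_mem (msuppMX p m)) => /mapP[m' _ ->]; exact: lem_addr.
Qed.

Variables (D : pred {set 'I_n}) (F : frame K D).
Hypothesis mD : monotone D.

Definition entry (s t : F) : S := fdiff s t *: 'X_[wmon (flab s) - wmon (flab t)].

Lemma entry_deg0 s t : fdeg s != (fdeg t).+1 -> entry s t = 0.
Proof. by move=> h; rewrite /entry fdiff_deg0 ?scale0r. Qed.

Lemma entryX s t : entry s t * 'X_[wmon (flab t)] = fdiff s t *: 'X_[wmon (flab s)].
Proof.
rewrite /entry; have [->|/fdiff_supp/andP[_ ts]] := eqVneq (fdiff s t) 0.
  by rewrite !scale0r mul0r.
by rewrite -scalerAl -mpolyXD submK // wmon_sub.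
Qed.

Lemma mulX_inj m : injective (fun p : S => p * 'X_[m]).
Proof. exact: mulIf (mpolyX_neq0 m). Qed.

Lemma sum_entryX (v : F -> S) t : (\sum_s v s * entry s t) * 'X_[wmon (flab t)] =
  \sum_s fdiff s t *: (v s * 'X_[wmon (flab s)]).
Proof.
by rewrite mulr_suml; apply: eq_bigr => s _; rewrite -mulrA entryX scalerAr.
Qed.

Lemma entry_sq r t : \sum_s entry r s * entry s t = 0.
Proof.
apply: (@mulX_inj (wmon (flab t))); rewrite mul0r sum_entryX.
under eq_bigr => s _ do rewrite entryX scalerA mulrC.
by rewrite -scaler_suml fdiff_sq scale0r.
Qed.

Lemma entry_exact (v : F -> S) : v (fbase F) = 0 ->
  (forall t, \sum_s v s * entry s t = 0) ->
  exists u : F -> S, forall t, v t = \sum_s u s * entry s t.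
Proof.
move=> vb vZ.
(* The part of v in multidegree m lives in the strand at full_exponents m. *)
pose V m t := (v t * 'X_[wmon (flab t)])@_m.
have VU m t : ~~ (flab t \subset full_exponents m) -> V m t = 0.
  by rewrite -wmon_le => tm; apply: mcoeffMX_out.
have VZ m t : \sum_s V m s * fdiff s t = 0.
  transitivity (((\sum_s v s * entry s t) * 'X_[wmon (flab t)])@_m); last first.
    by rewrite vZ mul0r mcoeff0.
  by rewrite sum_entryX raddf_sum /=; apply: eq_bigr => s _; rewrite mcoeffZ mulrC.
have lift m : exists u : F -> K,
    (forall t, ~~ (flab t \subset full_exponents m) -> u t = 0) /\
    forall t, V m t = \sum_s u s * fdiff s t.
  have [DU|nDU] := boolP (D (full_exponents m)); first exact: (fexact DU (VU m) (VZ m)).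
  exists (fun=> 0); split=> // t; rewrite big1 => [|s _]; last exact: mul0r.
  have [->|tb] := eqVneq t (fbase F); first by rewrite /V vb mul0r mcoeff0.
  by apply: VU; apply: contra nDU => tU; apply: mD tU (flab_dep tb).
pose N := \max_t msize (v t * 'X_[wmon (flab t)]).
have [u uP] := fin_all_exists (fun m : 'X_{1..n < N} => lift m).
exists (fun t => \sum_(m : 'X_{1..n < N}) u m t *: 'X_[m - wmon (flab t)]) => t.
apply: (@mulX_inj (wmon (flab t))); rewrite sum_entryX.
rewrite [LHS](mpolywE (k := N)); last exact: (leq_bigmax t).
transitivity (\sum_(m : 'X_{1..n < N}) \sum_s (u m s * fdiff s t) *: 'X_[K, m]).
  apply: eq_bigr => m _; rewrite -scaler_suml; congr (_ *: _).
  by have [_ uV] := uP m; exact: uV.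
rewrite exchange_big /=; apply: eq_bigr => s _; rewrite mulr_suml scaler_sumr.
apply: eq_bigr => m _; rewrite -scalerAl -mpolyXD scalerA [fdiff _ _ * _]mulrC.
have [sU|sU] := boolP (flab s \subset full_exponents m); first by rewrite submK // wmon_le.
by have [-> //] := uP m; rewrite mul0r !scale0r.
Qed.

Definition cells i : pred F := [pred t | fdeg t == i.+1].

(* Homological degrees drop by one: the frame resolves S/I, fcomplex resolves I. *)
Definition fcomplex : gfcomplex K n := @GFComplex K n
  (fun i => #|cells i|)
  (fun i (a : 'I_#|cells i|) => mdeg (wmon (flab (enum_val a))))
  (\matrix_(a, b) entry (enum_val a) (fbase F))
  (fun i => \matrix_(a, b) entry (enum_val a) (enum_val b)).

Lemma cellP i (a : 'I_#|cells i|) : fdeg (enum_val a) = i.+1.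
Proof. by have := enum_valP a => /eqP. Qed.

Lemma sum_cells i (f : F -> S) : (forall s, fdeg s != i.+1 -> f s = 0) ->
  \sum_s f s = \sum_(a < #|cells i|) f (enum_val a).
Proof.
move=> f0; rewrite (bigID (mem (cells i))) /= [X in _ + X]big1 ?addr0 //.
by rewrite big_enum_val.
Qed.

Definition extend i (v : 'rV[S]_#|cells i|) (t : F) : S :=
  \sum_(a | enum_val a == t) v 0 a.

Lemma extend_val i (v : 'rV[S]_#|cells i|) a : extend v (enum_val a) = v 0 a.
Proof.
by rewrite /extend (big_pred1 a) // => b; rewrite /= (inj_eq enum_val_inj).
Qed.

Lemma extend_out i (v : 'rV[S]_#|cells i|) t : fdeg t != i.+1 -> extend v t = 0.
Proof.
move=> ti; rewrite /extend big_pred0 // => a; apply: contraNF ti => /eqP <-.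
by rewrite cellP.
Qed.

Lemma sum_extend i (v : 'rV[S]_#|cells i|) (f : F -> S) :
  \sum_s extend v s * f s = \sum_a v 0 a * f (enum_val a).
Proof.
rewrite (sum_cells (i := i)) => [|s /extend_out ->]; last exact: mul0r.
by apply: eq_bigr => a _; rewrite extend_val.
Qed.

Lemma fcomplex_graded : graded fcomplex.
Proof.
split=> [a|i a b] /=; rewrite !mxE.
  by rewrite /entry flab_base wmon0 subm0; apply: dhomogZ; rewrite dhomogX.
rewrite /entry; have [->|/fdiff_supp/andP[_ ba]] := eqVneq (fdiff (enum_val a) (enum_val b)) 0.
  by rewrite scale0r eqxx; case: ifP => // _; apply: dhomog0.
have ab := wmon_sub ba.
rewrite -{1}(submK ab) mdegD leq_addl -mdegB_le //; apply: dhomogZ; by rewrite dhomogX.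
Qed.

Lemma fcomplex_finite : finite_length fcomplex.
Proof.
exists (\max_(t : F) fdeg t) => i lt_i; apply: eq_card0 => t; rewrite !inE.
by apply/negP => /eqP ti; move: lt_i; rewrite ltnNge (leq_trans _ (leq_bigmax t)) // ti.
Qed.

Lemma fcomplex_minimal : fminimal F -> minimal fcomplex.
Proof.
move=> mF i a b; rewrite mxE mcoeffZ mcoeffX /=.
have [->|nz] := eqVneq (fdiff (enum_val a) (enum_val b)) 0; first by rewrite mul0r.
have /andP[_ ba] := fdiff_supp nz.
by rewrite wmon_subE // (negPf (mF _ _ nz)) mulr0.
Qed.

Lemma exact_at i (v : 'rV[S]_#|cells i|) :
  (forall t, fdeg t = i -> \sum_a v 0 a * entry (enum_val a) t = 0) <->
  exists u, v = u *m diff fcomplex i.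
Proof.
split=> [vZ|[u ->] t ti]; last first.
  under eq_bigr => a _ do rewrite mxE mulr_suml.
  rewrite exchange_big big1 //= => b _.
  under eq_bigr => a _ do rewrite mxE -mulrA.
  rewrite -mulr_sumr -(sum_cells (f := fun s => entry (enum_val b) s * entry s t)).
    by rewrite entry_sq mulr0.
  by move=> s si; rewrite entry_deg0 ?mul0r // cellP eqSS eq_sym.
have [||u uP] := @entry_exact (extend v).
- by rewrite extend_out // fdeg_base.
- move=> t; have [ti|ti] := eqVneq (fdeg t) i; first by rewrite sum_extend vZ.
  rewrite big1 // => s _; have [si|/extend_out ->] := eqVneq (fdeg s) i.+1; last by rewrite mul0r.
  by rewrite entry_deg0 ?mulr0 // si eqSS eq_sym.
exists (\row_a u (enum_val a)); apply/rowP => b; rewrite -extend_val uP mxE.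
rewrite (sum_cells (i := i.+1)) => [|s si].
  by apply: eq_bigr => a _; rewrite !mxE.
by rewrite entry_deg0 ?mulr0 // cellP.
Qed.

Variables (E : finType) (P : pred E) (A : E -> {set 'I_n}) (g : E -> S).
Hypothesis DE : forall U, D U = [exists e, P e && (A e \subset U)].
Hypothesis gE : forall e, P e -> g e = 'X_[wmon (A e)].

Lemma fcomplex_resolves : resolves fcomplex (ideal_gen P g).
Proof.
have base_only t : fdeg t = 0%N -> t = fbase F by move/eqP; rewrite fdeg_eq0 => /eqP.
split; last 1 first.
- move=> i v; rewrite -(exact_at v); split=> [vZ t ti|vZ].
    have ti' : t \in cells i by rewrite inE ti.
    move/rowP: vZ => /(_ (enum_rank_in ti' t)); rewrite !mxE => vZ.
    rewrite -[RHS]vZ; apply: eq_bigr => a _.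
    by rewrite mxE enum_rankK_in.
  by apply/rowP => b; rewrite !mxE -[RHS](vZ _ (cellP b)); apply: eq_bigr => a _; rewrite mxE.
- move=> p; split=> [[c ->]|[v vp]].
    have gen e : exists u : F -> S, P e -> \sum_s u s * entry s (fbase F) = g e.
      have [Pe|] := boolP (P e); last by exists (fun=> 0).
      have De : D (A e) by rewrite DE; apply/existsP; exists e; rewrite Pe /=.
      have [||u [uU uP]] := fexact (f := F) (v := fun t => (t == fbase F)%:R) De.
      - by move=> t; case: eqP => // ->; rewrite flab_base sub0set.
      - move=> t; rewrite big1 // => s _; case: eqP => [->|]; last by rewrite mul0r.
        by rewrite fdiff_base mulr0.
      exists (fun s => u s *: 'X_[wmon (A e) - wmon (flab s)]) => _; rewrite gE //.
      apply: (@mulX_inj (wmon (flab (fbase F)))); rewrite sum_entryX.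
      rewrite flab_base wmon0 mpolyX0 mulr1 -[RHS]scale1r.
      have -> : 1 = \sum_s u s * fdiff s (fbase F) by rewrite -uP eqxx.
      rewrite scaler_suml; apply: eq_bigr => s _.
      rewrite -scalerAl scalerA [fdiff _ _ * _]mulrC.
      have [sU|/uU ->] := boolP (flab s \subset A e); last by rewrite mul0r !scale0r.
      by rewrite -mpolyXD submK // wmon_sub.
    have [u uP] := fin_all_exists gen.
    exists (\row_a \sum_(e | P e) c e * u e (enum_val a)).
    apply/rowP => j; rewrite !mxE !ord1 eqxx mulr1n.
    under eq_bigr => a _ do rewrite !mxE mulr_suml.
    rewrite exchange_big /=; apply: eq_bigr => e Pe; rewrite -(uP e Pe) mulr_sumr.
    rewrite [RHS](sum_cells (i := 0)) => [|s s0].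
      by apply: eq_bigr => a _; rewrite mulrA.
    by rewrite entry_deg0 ?mulr0 // fdeg_base.
  have dep (a : 'I_#|cells 0|) : exists e, P e && (A e \subset flab (enum_val a)).
    apply/existsP; rewrite -DE; apply: flab_dep; rewrite -fdeg_eq0 cellP //.
  have [f fP] := fin_all_exists dep.
  exists (fun e => \sum_(a | f a == e) v 0 a *
    (fdiff (enum_val a) (fbase F) *: 'X_[wmon (flab (enum_val a)) - wmon (A e)])).
  have -> : p = \sum_a v 0 a * entry (enum_val a) (fbase F).
    have /rowP/(_ 0) := vp; rewrite !mxE eqxx mulr1n => <-.
    by apply: eq_bigr => a _; rewrite mxE.
  under [RHS]eq_bigr => e _ do rewrite mulr_suml.
  rewrite (exchange_big_dep xpredT) //=; apply: eq_bigr => a _.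
  have /andP[Pf Af] := fP a.
  rewrite (big_pred1 (f a)) => [|e]; last first.
    by rewrite /= eq_sym andb_idl // => /eqP ->.
  rewrite gE // -mulrA /entry flab_base wmon0 subm0; congr (_ * _).
  by rewrite -scalerAl -mpolyXD submK // wmon_sub.
- move=> v; rewrite -(exact_at v); split=> [vZ t /base_only ->|vZ].
    by have /rowP/(_ 0) := vZ; rewrite !mxE => {2}<-; apply: eq_bigr => a _; rewrite mxE.
  apply/rowP => j; rewrite !mxE !ord1 -[RHS](vZ _ (fdeg_base F)).
  by apply: eq_bigr => a _; rewrite mxE.
Qed.

Lemma frame_is_reg (r : nat) : fminimal F ->
    (forall i a, fgen F i.+1 a -> (mdeg (wmon a) <= r + i)%N) ->
    (exists i a, fgen F i.+1 a /\ mdeg (wmon a) = (r + i)%N) ->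
  is_reg (ideal_gen P g) r%:Z.
Proof.
move=> mF le_r [i [a [[t [ti ta]] Ei]]]; exists fcomplex; split.
- split; [exact: fcomplex_graded|exact: fcomplex_resolves|exact: fcomplex_finite|].
  exact: fcomplex_minimal.
- exists i, (r + i)%N; split; last by rewrite PoszD addrK.
  apply/eqP; rewrite -lt0n; apply/card_gt0P.
  have ti' : t \in cells i by rewrite inE ti.
  by exists (enum_rank_in ti' t); rewrite inE /= enum_rankK_in // ta Ei.
- move=> {a ta Ei ti}i j /eqP; rewrite -lt0n => /card_gt0P[a]; rewrite inE /= => /eqP <-.
  have : (mdeg (wmon (flab (enum_val a))) <= r + i)%N.
    by apply: le_r; exists (enum_val a); rewrite cellP.
  lia.
Qed.

End Realization.

(** * Frames of paths and cycles *)

Section Cycle.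
Variables (K : fieldType) (n : nat).
Implicit Types (U a b : {set 'I_n}) (p : pred nat).

Definition vset p : {set 'I_n} := [set x : 'I_n | p x].
Definition seg s j := vset (fun x => s <= x <= s + j)%N.
Definition hasv k U := [exists x : 'I_n, (x \in U) && (x == k :> nat)].

Definition path_dep s j U := has (fun i => hasv i U && hasv i.+1 U) (iota s j).

Lemma hasv_in (x : 'I_n) U : hasv x U = (x \in U).
Proof.
apply/existsP/idP => [[y /andP[yU /eqP/val_inj <-]] //|xU].
by exists x; rewrite xU eqxx.
Qed.

Lemma hasvS k : monotone (hasv k).
Proof.
move=> U U' /subsetP UU' /existsP[x /andP[xU xk]]; apply/existsP; exists x.
by rewrite UU'.
Qed.

Lemma vset2_sub k l U : (k < n)%N -> (l < n)%N ->
  (vset (fun x => (x == k) || (x == l)) \subset U) = hasv k U && hasv l U.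
Proof.
move=> kn ln; rewrite -[k]/(val (Ordinal kn)) -[l]/(val (Ordinal ln)) !hasv_in.
apply/subsetP/andP => [h|[hk hl] x].
  by split; apply: h; rewrite inE /= eqxx ?orbT.
by rewrite inE => /orP[] /eqP/val_inj ->.
Qed.

Lemma seg0_sub k U : (k < n)%N -> (seg k 0 \subset U) = hasv k U.
Proof.
move=> kn; have <- : vset (fun x => (x == k) || (x == k)) = seg k 0.
  by apply/setP => x; rewrite !inE; lia.
by rewrite vset2_sub // andbb.
Qed.

Lemma seg1_sub k U : (k.+1 < n)%N -> (seg k 1 \subset U) = hasv k U && hasv k.+1 U.
Proof.
move=> kn; have <- : vset (fun x => (x == k) || (x == k.+1)) = seg k 1.
  by apply/setP => x; rewrite !inE; lia.
by rewrite vset2_sub // ltnW.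
Qed.

Lemma card_vset2 k l : (#|vset (fun x => (x == k) || (x == l))| <= 2)%N.
Proof.
rewrite cardE -(size_map val).
apply: (@leq_trans (size [:: k; l])) => //; apply: uniq_leq_size.
  by rewrite map_inj_uniq ?enum_uniq //; exact: val_inj.
by move=> _ /mapP[x + ->]; rewrite mem_enum !inE.
Qed.

Lemma card_seg0 k : (#|seg k 0| <= 1)%N.
Proof.
rewrite cardE -(size_map val).
apply: (@leq_trans (size [:: k])) => //; apply: uniq_leq_size.
  by rewrite map_inj_uniq ?enum_uniq //; exact: val_inj.
by move=> _ /mapP[x + ->]; rewrite mem_enum !inE /=; lia.
Qed.

Lemma card_seg1 k : (#|seg k 1| <= 2)%N.
Proof.
apply: leq_trans (card_vset2 k k.+1); apply: subset_leq_card.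
by apply/subsetP => x; rewrite !inE; lia.
Qed.

Lemma path_depS s j : monotone (path_dep s j).
Proof.
move=> U U' UU' /hasP[i si /andP[h1 h2]]; apply/hasP; exists i => //.
by rewrite !(hasvS UU').
Qed.

Lemma monotoneU D a : monotone D -> monotone (fun U => D U || (a \subset U)).
Proof.
move=> mD U U' UU' /orP[/(mD _ _ UU') -> //|aU].
by rewrite (subset_trans aU UU') orbT.
Qed.

Lemma adjoin_vertex D (F : frame K D) k : monotone D ->
  exists F' : frame K (fun U => D U || (seg k 0 \subset U)), forall i a,
    fgen F' i a <->
    fgen F i a \/ exists j b, [/\ fgen F j b, i = j.+1 & a = b :|: seg k 0].
Proof. by move=> mD; apply: cone. Qed.

(* [path_dep s j] is the path with j edges on the vertices s, .., s+j. Its full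
   multidegree carries no Betti number for j = 0 mod 3, and only one, in
   homological degree (2j+1)/3, for j = 1 mod 3. *)
Definition path_spec s j (F : frame K (path_dep s j)) :=
  (forall i a, fgen F i a ->
     [/\ a \subset seg s j, (#|a| <= i + (j + 2) %/ 3)%N,
         (j %% 3 = 0)%N -> a <> seg s j &
         (j %% 3 = 1)%N -> a = seg s j -> (3 * i = 2 * j + 1)%N]) /\
  ((j %% 3 = 1)%N -> exists i, fgen F i (seg s j)).

Lemma seg_mem s j (x : 'I_n) : (x \in seg s j) = (s <= x <= s + j)%N.
Proof. by rewrite inE. Qed.

Lemma segS s j j' : (j <= j')%N -> seg s j \subset seg s j'.
Proof. by move=> jj; apply/subsetP => x; rewrite !seg_mem; lia. Qed.

Lemma path_dep_recr s j U :
  path_dep s j.+1 U = path_dep s j U || (hasv (s + j) U && hasv (s + j).+1 U).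
Proof. by rewrite /path_dep -[in LHS]addn1 iotaD has_cat /= orbF. Qed.

(* The colon of the ideal of a path by its next edge: the neighbouring vertex and
   the path with two edges fewer (one, for a path with a single edge). *)
Lemma path_colon s j U : (s + j.+2 < n)%N -> seg (s + j.+1) 1 \subset U ->
  path_dep s j.-1 U || (seg (s + j) 0 \subset U) = path_dep s j.+1 U.
Proof.
move=> lt_n; rewrite seg1_sub ?seg0_sub; [|lia|lia]; case/andP=> hU _.
rewrite path_dep_recr -addnS hU andbT; case: j {hU lt_n} => [|j] //.
by rewrite path_dep_recr -addnS; case: (hasv (s + j.+1) U); rewrite /= ?andbF ?orbT ?orbF.
Qed.

Lemma path_frame s j : (s + j < n)%N -> exists F, @path_spec s j F.
Proof.
have [k] := ubnP j; elim: k j => // k IH [|[|j]] lt_jk lt_n.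
- have [F0 F0g] := frame_false K 'I_n.
  have [F Fg] := @frame_ext K _ xpred0 (path_dep s 0) (fun=> erefl) F0.
  exists F; split=> [i a /Fg/F0g[-> ->]|//]; split=> //; first exact: sub0set.
    by rewrite cards0.
  by move=> _ /setP/(_ (Ordinal lt_n)); rewrite in_set0 seg_mem /=; lia.
- have [F0 F0g] := frame_false K 'I_n.
  have [//|//|//|F1 F1g] := @cone K _ xpred0 xpred0 (seg s 1) F0 F0.
  have [|F Fg] := @frame_ext K _ _ (path_dep s 1) _ F1.
    by move=> U; rewrite /= /path_dep /= orbF seg1_sub //; lia.
  have segs : seg s 1 <> set0.
    have sn : (s < n)%N by lia.
    by move/setP/(_ (Ordinal sn)); rewrite in_set0 seg_mem /=; lia.
  exists F; split=> [i a|_].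
    case/Fg/F1g => [/F0g[-> ->]|[_ [_ [/F0g[-> ->] -> ->]]]].
      by split=> //; [exact: sub0set|rewrite cards0|move=> _ /esym].
    rewrite set0U; split=> //; apply: leq_trans (card_seg1 s) _; lia.
  by exists 1%N; apply/Fg/F1g; right; exists 0%N, set0; rewrite set0U; split=> //; apply/F0g.
have [||F1 [F1g _]] := IH j.+1; [lia|lia|].
have [||F0 [F0g F0e]] := IH j.-1; [lia|lia|].
have [|F2 F2g] := adjoin_vertex F0 (s + j); first exact: path_depS.
have [||U AU|F3 F3g] := @cone K _ _ _ (seg (s + j.+1) 1) F1 F2.
- exact: path_depS.
- exact/monotoneU/path_depS.
- exact: path_colon.
have [|F Fg] := @frame_ext K _ _ (path_dep s j.+2) _ F3.
  move=> U; rewrite seg1_sub; last by lia.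
  by rewrite [RHS]path_dep_recr -addnS.
have vn : (s + j < n)%N by lia.
have tn : (s + j.+2 < n)%N by lia.
exists F; split=> [i a|j1].
  case/Fg/F3g => [/F1g[sa ca _ _]|[i2 [b2 [/F2g gb -> ->]]]].
    have ne : a <> seg s j.+2.
      move=> E; have : Ordinal tn \in a by rewrite E seg_mem /=; lia.
      by move/(subsetP sa); rewrite seg_mem /=; lia.
    split=> //; first by apply: subset_trans sa (segS _ _).
    by apply: leq_trans ca _; lia.
  case: gb => [/F0g[sb cb _ _]|[i0 [b [/F0g[sb cb b0 b1] -> ->]]]].
    have ne : (0 < j)%N -> b2 :|: seg (s + j.+1) 1 <> seg s j.+2.
      move=> j0 E; have : Ordinal vn \in b2 :|: seg (s + j.+1) 1 by rewrite E seg_mem /=; lia.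
      rewrite in_setU => /orP[/(subsetP sb)|]; rewrite seg_mem /=; lia.
    split.
    + rewrite subUset (subset_trans sb (segS _ _)) /=; last by lia.
      by apply/subsetP => x; rewrite !seg_mem; lia.
    + apply: leq_trans (leq_card_setU _ _) _; have := card_seg1 (s + j.+1); lia.
    + by move=> j3; apply: ne; lia.
    + by move=> j3 /ne; case; lia.
  have bE : (0 < j)%N -> b :|: seg (s + j) 0 :|: seg (s + j.+1) 1 = seg s j.+2 -> b = seg s j.-1.
    move=> j0 E; apply/eqP; rewrite eqEsubset sb; apply/subsetP => x xs.
    have : x \in seg s j.+2 by move: xs; rewrite !seg_mem; lia.
    by rewrite -E !in_setU -orbA => /or3P[//||]; move: xs; rewrite !seg_mem; lia.
  split.
  + rewrite !subUset (subset_trans sb (segS _ _)) /=; last by lia.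
    by apply/andP; split; apply/subsetP => x; rewrite !seg_mem; lia.
  + apply: leq_trans (leq_card_setU _ _) _; have := card_seg1 (s + j.+1).
    have := (leq_card_setU b (seg (s + j) 0)).1; have := card_seg0 (s + j); lia.
  + by move=> j3 /bE -/(_ ltac:(lia)); apply: b0; lia.
  + by move=> j3 /bE -/(_ ltac:(lia))/b1; lia.
have [|i Fi] := F0e; first by lia.
exists i.+2; apply/Fg/F3g; right; exists i.+1, (seg s j.-1 :|: seg (s + j) 0).
split=> //; first by apply/F2g; right; exists i, (seg s j.-1).
by apply/setP => x; rewrite !in_setU !seg_mem; lia.
Qed.

Definition closing := vset (fun x => (x == 0%N) || (x == n.-1)).
Definition cycle_dep U := path_dep 0 n.-1 U || (closing \subset U).

Lemma cycle_frame k : n = (3 * k + 5)%N ->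
  exists F : frame K cycle_dep,
    (forall i a, fgen F i a -> (#|a| <= i + k + 2)%N /\ (a = setT -> i = (2 * k + 3)%N)) /\
    fgen F (2 * k + 3) setT.
Proof.
move=> nE.
have [|F1 [F1g F1e]] := @path_frame 0 n.-1; first by lia.
have [|F0 [F0g _]] := @path_frame 2 (n - 5); first by lia.
have [|F2 F2g] := adjoin_vertex F0 1; first exact: path_depS.
have [|F3 F3g] := adjoin_vertex F2 (n - 2); first exact/monotoneU/path_depS.
have [||U AU|F Fg] := @cone K _ _ _ closing F1 F3.
- exact: path_depS.
- exact/monotoneU/monotoneU/path_depS.
- move: AU; rewrite vset2_sub ?seg0_sub; try lia; case/andP=> h0 hn.
  rewrite /path_dep; have -> : n.-1 = (2 + ((n - 5) + 2))%N by lia.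
  rewrite iotaD has_cat iotaD has_cat /= h0 add0n /= !orbF.
  have -> : (2 + (n - 5)).+1 = (n - 2)%N by lia.
  have -> : (n - 2).+1 = n.-1 by lia.
  by rewrite hn andbT; case: (hasv 1 U); case: (hasv (n - 2) U); rewrite ?andbF ?orbF ?orbT.
have full : seg 0 n.-1 = setT by apply/setP => x; rewrite seg_mem inE; have := ltn_ord x; lia.
exists F; split=> [i a|].
  case/Fg=> [/F1g[_ ca _ aE]|[i3 [b3 [/F3g g3 -> ->]]]].
    by split=> [|aT]; [lia|have := aE ltac:(lia); rewrite full => /(_ aT); lia].
  have E i0 b (c : {set 'I_n}) : fgen F0 i0 b -> (forall x : 'I_n, x \in c -> ~~ (2 <= x <= n - 3)%N) ->
      b :|: c <> setT.
    case/F0g=> sb _ b0 _ cx bT; apply: b0; first by lia.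
    apply/eqP; rewrite eqEsubset sb; apply/subsetP => x xs.
    have : x \in b :|: c by rewrite bT.
    by rewrite in_setU => /orP[//|/cx]; move: xs; rewrite seg_mem; lia.
  have cc : (#|closing| <= 2)%N := card_vset2 0 n.-1; have c1 := card_seg0 1; have c2 := card_seg0 (n - 2).
  case: g3 => [/F2g|[i2 [b2 [/F2g + -> ->]]]].
    case=> [g0|[i0 [b0 [g0 -> ->]]]].
      have [_ cb _ _] := F0g _ _ g0.
      split; last by move=> bT; case: (E _ _ closing g0 _ bT) => x; rewrite inE; lia.
      apply: leq_trans (leq_card_setU _ _) _; lia.
    have [_ cb _ _] := F0g _ _ g0; rewrite -setUA; split.
      apply: leq_trans (leq_card_setU _ _) _.
      have := (leq_card_setU (seg 1 0) closing).1; lia.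
    move=> bT; case: (E _ _ _ g0 _ bT) => x; rewrite in_setU seg_mem inE; lia.
  case=> [g0|[i0 [b0 [g0 -> ->]]]].
    have [_ cb _ _] := F0g _ _ g0; rewrite -setUA; split.
      apply: leq_trans (leq_card_setU _ _) _.
      have := (leq_card_setU (seg (n - 2) 0) closing).1; lia.
    move=> bT; case: (E _ _ _ g0 _ bT) => x; rewrite in_setU seg_mem inE; lia.
  have [_ cb _ _] := F0g _ _ g0; rewrite -!setUA; split.
    apply: leq_trans (leq_card_setU _ _) _.
    have := (leq_card_setU (seg 1 0) (seg (n - 2) 0 :|: closing)).1.
    have := (leq_card_setU (seg (n - 2) 0) closing).1; lia.
  move=> bT; case: (E _ _ _ g0 _ bT) => x; rewrite !in_setU !seg_mem inE; lia.
have [|i Fi] := F1e; first by lia.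
have [_ _ _ iE] := F1g _ _ Fi; rewrite -full; apply/Fg; left.
by have -> : (2 * k + 3)%N = i by have := iE ltac:(lia) erefl; lia.
Qed.

End Cycle.

Lemma cycle_dep_edges n (P : rel 'I_n) (U : {set 'I_n}) : (3 <= n)%N ->
    (forall x y, P x y || P y x = (y == ordS x) || (x == ordS y)) ->
  cycle_dep U = [exists e : 'I_n * 'I_n, P e.1 e.2 && ([set e.1; e.2] \subset U)].
Proof.
move=> n3 PE; have n0 : (0 < n)%N by lia.
have -> : cycle_dep U = [exists x : 'I_n, (x \in U) && (ordS x \in U)].
  rewrite /cycle_dep vset2_sub; [|lia|lia].
  apply/idP/existsP => [|[x /andP[xU sU]]].
    case/orP=> [/hasP[i]|/andP[/existsP[y /andP[yU /eqP y0]] /existsP[x /andP[xU /eqP xn]]]].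
      rewrite mem_iota => /= lt_i /andP[/existsP[x /andP[xU /eqP xi]] /existsP[y /andP[yU /eqP yi]]].
      exists x; rewrite xU; suff -> : ordS x = y by [].
      by apply: val_inj; rewrite /= xi yi modn_small; lia.
    exists x; rewrite xU; suff -> : ordS x = y by [].
    by apply: val_inj; rewrite /= xn y0 prednK // modnn.
  have [lt_x|ge_x] := ltnP x.+1 n.
    apply/orP; left; apply/hasP; exists (val x); first by rewrite mem_iota /=; lia.
    have sx : ordS x = x.+1 :> nat by rewrite /= modn_small.
    by rewrite -sx !hasv_in xU.
  have xn : x = n.-1 :> nat by have := ltn_ord x; lia.
  have s0 : ordS x = 0%N :> nat by rewrite /= xn prednK // modnn.
  by apply/orP; right; rewrite -xn -s0 !hasv_in sU.
apply/existsP/existsP => [[x /andP[xU sU]]|[[x y] /= /andP[Pxy]]].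
  have := PE x (ordS x); rewrite eqxx /= => /orP[Px|Px]; [exists (x, ordS x)|exists (ordS x, x)].
    by rewrite Px subUset !sub1set xU.
  by rewrite Px subUset !sub1set xU sU.
rewrite subUset !sub1set => /andP[xU yU].
have := PE x y; rewrite Pxy /= => /esym/orP[/eqP E|/eqP E].
  by exists x; rewrite xU -E.
by exists y; rewrite yU -E.
Qed.

Lemma reg_weighted_cycle (K : fieldType) (n : nat) (w : 'I_n -> nat) (P : rel 'I_n)
    (g : 'I_n * 'I_n -> {mpoly K[n]}) k :
    n = (3 * k + 5)%N -> (forall i, 0 < w i)%N ->
    (forall x y, P x y || P y x = (y == ordS x) || (x == ordS y)) ->
    (forall e, P e.1 e.2 -> g e = 'X_[wmon w [set e.1; e.2]]) ->
  reg (ideal_gen (fun e => P e.1 e.2) g) = (k + 3 + \sum_i (w i - 1))%N%:Z.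
Proof.
move=> nE w0 PE gE; apply: is_reg_reg.
have [F0 [F0g F0T]] := cycle_frame K nE.
have cyc0 : ~~ cycle_dep (set0 : {set 'I_n}).
  rewrite /cycle_dep vset2_sub; [|lia|lia]; rewrite negb_or; apply/andP; split.
    by apply/hasPn => i _; apply/negP => /andP[/existsP[x]]; rewrite in_set0.
  by apply/negP => /andP[/existsP[x]]; rewrite in_set0.
have [F [mF Fg Fk]] := minimal_frame F0 cyc0.
have FT : fgen F (2 * k + 3) setT.
  apply: Fk => // [/F0g[_ /(_ erefl)]|j E /F0g[_ /(_ erefl)]]; lia.
have wsplit (a : {set 'I_n}) : (\sum_(i in a) w i = #|a| + \sum_(i in a) (w i - 1))%N.
  rewrite -sum1_card -big_split /=; apply: eq_bigr => i _; have := w0 i; lia.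
apply: (@frame_is_reg K n w w0 _ F _ _ _ (fun e => [set e.1; e.2])) => //.
- exact/monotoneU/path_depS.
- by move=> U; apply: cycle_dep_edges PE; lia.
- move=> i a /Fg/F0g[ca _]; rewrite mdeg_wmon wsplit.
  have : (\sum_(i in a) (w i - 1) <= \sum_i (w i - 1))%N.
    by rewrite [leqRHS](bigID (mem a)) /= leq_addr.
  lia.
- exists (2 * k + 2)%N, setT; split; first by rewrite -addnS.
  rewrite mdeg_wmon wsplit cardsT card_ord.
  have -> : (\sum_(i in [set: 'I_n]) (w i - 1) = \sum_i (w i - 1))%N.
    by apply: eq_bigl => i; rewrite inE.
  lia.
Qed.

Theorem theorem4p5 (K : fieldType) (n : nat) (D : wograph n)
    (n_ge3 : (3 <= n)%N) (n_mod3 : n = 2 %[mod 3])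
    (cycD : is_cycle (underlying D))
    (sinkD : forall x, x \in Vplus D -> sink D x) :
  reg (wo_edge_ideal K D) =
  reg (edge_ideal K (underlying D)) +
    \sum_(x in Vplus D) ((wt D x)%:Z - 1).
Proof.
have [k nE] : exists k, n = (3 * k + 5)%N.
  by exists ((n - 5) %/ 3)%N; move: n_mod3; rewrite [(2 %% 3)%N]/=; lia.
have tail1 x y : Defs.arc D x y -> wt D x = 1%N.
  move=> xy; have : x \notin Vplus D.
    apply/negP => /sinkD/(_ y); rewrite /under_edge xy => /(_ isT) yx.
    by have := arc_asym xy; rewrite yx.
  by rewrite inE; have := wt_gt0 D x; lia.
have xneqy x y : under_edge D x y -> (x == y) = false.
  by move=> xy; apply/eqP => E; rewrite E under_edge_irrefl in xy.
have arcM e : Defs.arc D e.1 e.2 ->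
    'X_(e.1) * 'X_(e.2) ^+ wt D e.2 = 'X_[wmon (wt D) [set e.1; e.2]] :> {mpoly K[n]}.
  move: e => [x y] /= xy; have xy' : (x == y) = false by rewrite xneqy // /under_edge xy.
  rewrite mpolyXn -mpolyXD; congr 'X_[_]; apply/mnmP => i.
  rewrite !mnmE in_set2 mulmnE mnmE.
  case: (eqVneq i x) => [->|ix] /=; first by rewrite (tail1 x y) // eq_sym xy'.
  by rewrite add0n; case: (eqVneq i y) => [->|_] /=; rewrite ?mul1n ?mul0n.
have edgeM e : edge (underlying D) e.1 e.2 ->
    'X_(e.1) * 'X_(e.2) = 'X_[wmon (fun=> 1%N) [set e.1; e.2]] :> {mpoly K[n]}.
  move: e => [x y] /= xy; rewrite -mpolyXD; congr 'X_[_]; apply/mnmP => i.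
  rewrite !mnmE in_set2; case: (eqVneq i x) => [->|ix] /=; first by rewrite eq_sym xneqy.
  by rewrite add0n; case: (eqVneq i y).
have edgeE x y : under_edge D x y || under_edge D y x = (y == ordS x) || (x == ordS y).
  by rewrite [under_edge D y x]under_edge_sym orbb; exact: cycD.
rewrite /wo_edge_ideal (reg_weighted_cycle nE (wt_gt0 D) cycD arcM).
rewrite /edge_ideal (@reg_weighted_cycle _ _ (fun=> 1%N) _ _ _ nE (fun=> isT) edgeE edgeM).
rewrite [X in _ = (_ + X)%N%:Z + _]big1 // addn0 PoszD; congr (_ + _).
rewrite (big_morph Posz PoszD (erefl _)) (bigID (mem (Vplus D))) /= [X in _ + X]big1 ?addr0.
  by apply: eq_bigr => x; rewrite inE => wx; rewrite subzn // ltnW.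
by move=> x; rewrite inE; have := wt_gt0 D x; lia.
Qed.
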